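(* Let $p_1,q_1,p_2,q_2$ be real numbers with $1\le p_1\le q_1<\infty$ and $1\le p_2\le q_2<\infty$. If $p_1\le p_2$ and $\frac{q_1}{q_2}\le\frac{p_1}{p_2}$, then $w\ell^{p_1}_{q_1}\subseteq w\ell^{p_2}_{q_2}$, with $\|x\|_{w\ell^{p_2}_{q_2}}\le\|x\|_{w\ell^{p_1}_{q_1}}$ for every $x\in w\ell^{p_1}_{q_1}$. Moreover, $w\ell^{p_2}_{q_2}\setminus w\ell^{p_1}_{q_1}\neq\emptyset$ whenever ($p_1<p_2$ and $\frac{q_1}{q_2}\le\frac{p_1}{p_2}$) or ($p_1\le p_2$ and $\frac{q_1}{q_2}<\frac{p_1}{p_2}$).
   Context: For $m\in\mathbb{Z}$ and $N\in\mathbb{N}_0=\mathbb{N}\cup\{0\}$ let $S_{m,N}:=\{m-N,\ldots,m,\ldots,m+N\}\subset\mathbb{Z}$, so $|S_{m,N}|=2N+1$. For $1\le p\le q<\infty$, the weak type discrete Morrey space $w\ell^p_q$ is the set of all scalar sequences $x=(x_j)_{j\in\mathbb{Z}}$ for which the quasi-norm $$\|x\|_{w\ell^p_q}:=\sup_{m\in\mathbb{Z},\,N\in\mathbb{N}_0,\,\gamma>0}\gamma\,|S_{m,N}|^{\frac1q-\frac1p}\,\big|\{j\in S_{m,N}:|x_j|>\gamma\}\big|^{\frac1p}$$ is finite, where $|A|$ denotes the cardinality of a finite set $A$. *)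

(* Defs.v *)
From HB Require Import structures.
From mathcomp Require Import all_boot all_order all_algebra finmap.
From mathcomp Require Import complex.
From mathcomp Require Import all_classical all_reals all_analysis.
From mathcomp Require Import zify.

Set Implicit Arguments.
Unset Strict Implicit.
Unset Printing Implicit Defensive.

Import Order.TTheory GRing.Theory Num.Theory.

Local Open Scope fset_scope.
Local Open Scope classical_set_scope.
Local Open Scope ring_scope.

(* "Scalar" may mean real or complex: statements quantify over both choices. *)
Variant scalar_kind := RealScalars | ComplexScalars.

Definition scalars (R : realType) (k : scalar_kind) : Type :=
  match k with RealScalars => R | ComplexScalars => R[i] end.

(* The norm of R[i] as a numFieldType takes its values in R[i]; its real part
   is the usual real-valued modulus. *)
Definition modulus (R : realType) (k : scalar_kind) : scalars R k -> R :=
  match k return scalars R k -> R with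
  | RealScalars => fun a => `|a|
  | ComplexScalars => fun z => complex.Re `|z|
  end.

Definition window (m : int) (N : nat) : {fset int} :=
  seq_fset tt [seq m - N%:Z + i%:Z | i <- iota 0 N.*2.+1].

Lemma in_window (m : int) (N : nat) (j : int) :
  (j \in window m N) = (m - N%:Z <= j <= m + N%:Z).
Proof.
rewrite seq_fsetE; apply/mapP/idP => [[t]|/andP[mj jm]].
  by rewrite mem_iota => tN ->; lia.
by exists (absz (j - (m - N%:Z))%R); [rewrite mem_iota|]; lia.
Qed.

Lemma card_window (m : int) (N : nat) : #|` window m N| = N.*2.+1.
Proof.
rewrite size_seq_fset undup_id ?size_map ?size_iota//.
by rewrite map_inj_uniq ?iota_uniq// => a b; lia.
Qed.

Lemma complex_modulusE (R : realType) (a b : R) :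
  modulus (k := ComplexScalars) (Complex a b) = Num.sqrt (a ^+ 2 + b ^+ 2).
Proof. by []. Qed.

Definition weak_morrey_norm (R : realType) (k : scalar_kind) (p q : R)
    (x : int -> scalars R k) : \bar R :=
  ereal_sup [set r : \bar R | exists (m : int) (N : nat) (gamma : R),
    0 < gamma /\
    r = (gamma * (#|` window m N|%:R `^ (1 / q - 1 / p))
         * (#|` [fset j in window m N | (gamma < modulus (x j))%R]%fset|%:R
              `^ (1 / p)))%:E].

Definition weak_morrey (R : realType) (k : scalar_kind) (p q : R) :
    set (int -> scalars R k) :=
  [set x | (weak_morrey_norm p q x < +oo)%E].

Arguments weak_morrey R k p q : clear implicits.

(* Main.v *)
(** If [x] has norm [K] in the first space, windows of radius 0 give
    [gamma <= K] whenever some entry exceeds [gamma]. Writing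
    [gamma = gamma^(1-t) gamma^t] with [t = p1/p2] and bounding the first factor
    by [K^(1-t)], the second norm is controlled by [K^(1-t) K^t = K].

    For strictness, either hypothesis forces [q1 < q2]. The sequence
    [(1+|j|)^(-1/q2)] is in weak [l^q2], hence in the second space, while the
    windows centred at 0 show that its first norm is at least of order
    [N^(1/q1-1/q2)] for every [N]. *)
Require Import Defs.
From mathcomp Require Import all_boot all_order all_algebra finmap.
From mathcomp Require Import complex.
From mathcomp Require Import all_classical all_reals all_analysis.
From mathcomp Require Import zify lra.

Set Implicit Arguments.
Unset Strict Implicit.
Unset Printing Implicit Defensive.

Import Order.TTheory GRing.Theory Num.Theory.

Local Open Scope fset_scope.
Local Open Scope classical_set_scope.
Local Open Scope ring_scope.

Section WeakMorrey.
Variables (R : realType) (k : scalar_kind).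
Implicit Types (x : int -> scalars R k) (p q gamma K : R) (m : int) (N : nat).

(** Lets a single real sequence serve as witness for both choices of scalars. *)
Definition of_real (a : R) : scalars R k :=
  match k return scalars R k with
  | RealScalars => a
  | ComplexScalars => Complex a 0
  end.

Lemma modulus_of_real (a : R) : modulus (of_real a) = `|a|.
Proof.
rewrite /of_real; case: k => //.
by rewrite complex_modulusE expr0n /= addr0 sqrtr_sqr.
Qed.

Definition level_set x m N gamma : {fset int} :=
  [fset j in window m N | (gamma < modulus (x j))%R]%fset.

Definition morrey_term p q x m N gamma : R :=
  gamma * (#|` window m N|%:R `^ (1 / q - 1 / p))
    * (#|` level_set x m N gamma|%:R `^ (1 / p)).

Lemma level_setP x m N gamma j :
  reflect (j \in window m N /\ gamma < modulus (x j))
    (j \in level_set x m N gamma).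
Proof. by rewrite !inE /=; apply: andP. Qed.

Lemma card_level_set_le x m N gamma :
  (#|` level_set x m N gamma| <= #|` window m N|)%N.
Proof. by apply: fsubset_leq_card; apply/fsubsetP => j /level_setP[]. Qed.

Lemma morrey_term_le_norm p q x m N gamma : 0 < gamma ->
  ((morrey_term p q x m N gamma)%:E <= weak_morrey_norm p q x)%E.
Proof. by move=> g0; apply: ereal_sup_ubound; exists m, N, gamma. Qed.

Lemma weak_morrey_norm_le p q x K :
  (forall m N gamma, 0 < gamma -> morrey_term p q x m N gamma <= K) ->
  (weak_morrey_norm p q x <= K%:E)%E.
Proof.
move=> H; apply: ge_ereal_sup => _ [m [N [gamma [g0 ->]]]].
by rewrite lee_fin; exact: H.
Qed.

Lemma morrey_term_empty p q x m N gamma : 1 <= p ->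
  #|` level_set x m N gamma| = 0%N -> morrey_term p q x m N gamma = 0.
Proof.
move=> p1 n0; rewrite /morrey_term n0 powR0 ?mulr0//.
by rewrite div1r invr_neq0//; lra.
Qed.

(** The exponents [1 / q - 1 / p] and [1 / p] then act on the same cardinality and add up to
    [1 / q]. *)
Lemma morrey_term_full p q x m N gamma : 1 <= p ->
  (forall j, j \in window m N -> gamma < modulus (x j)) ->
  morrey_term p q x m N gamma = gamma * (N.*2.+1%:R `^ (1 / q)).
Proof.
move=> p1 H; rewrite /morrey_term.
have -> : level_set x m N gamma = window m N.
  apply/fsetP => j; apply/level_setP/idP => [[]//|jW].
  by split=> //; exact: H.
rewrite card_window -mulrA -powRD ?subrK//.
by apply/implyP => _; rewrite pnatr_eq0.
Qed.

Lemma level_le_morrey_bound p q x K m N gamma : 1 <= p -> 0 < gamma ->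
  (forall m N gamma, 0 < gamma -> morrey_term p q x m N gamma <= K) ->
  (0 < #|` level_set x m N gamma|)%N -> gamma <= K.
Proof.
move=> p1 g0 H; rewrite cardfs_gt0 => /fset0Pn[j /level_setP[_ gj]].
have := H j 0%N _ g0; rewrite morrey_term_full//.
  by rewrite powR1 mulr1.
by move=> i; rewrite in_window => ij; have -> : i = j by lia.
Qed.

Lemma morrey_term_interpolate p1 q1 p2 q2 x K m N gamma :
  1 <= p1 -> 1 <= q1 -> 1 <= q2 -> p1 <= p2 -> q1 / q2 <= p1 / p2 ->
  (forall m N gamma, 0 < gamma -> morrey_term p1 q1 x m N gamma <= K) ->
  0 < gamma -> morrey_term p2 q2 x m N gamma <= K.
Proof.
move=> hp1 hq1 hq2 hp hq H g0.
have p1_gt0 : 0 < p1 by lra.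
have p2_gt0 : 0 < p2 by lra.
have q1_gt0 : 0 < q1 by lra.
have q2_gt0 : 0 < q2 by lra.
(* The bound [gamma <= K] needs an entry above [gamma], so the empty level set is treated apart. *)
have [n0|n_gt0] := posnP #|` level_set x m N gamma|.
  rewrite morrey_term_empty//; last lra.
  by apply: le_trans (H m N _ g0); rewrite !mulr_ge0 ?powR_ge0// ltW.
have gK := level_le_morrey_bound hp1 g0 H n_gt0.
have K_gt0 : 0 < K by exact: lt_le_trans gK.
pose t := p1 / p2.
have t_ge0 : 0 <= t by rewrite divr_ge0// ltW.
have t_le1 : t <= 1 by rewrite ler_pdivrMr// mul1r.
have powt (y : R) : 0 < y -> y `^ (1 - t) * y `^ t = y.
  move=> y0; rewrite -powRD ?subrK ?powRr1 ?ltW//.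
  by rewrite gt_eqF// implybT.
have /(@ge0_ler_powR _ t t_ge0) := H m N _ g0.
rewrite !nnegrE (ltW K_gt0) !mulr_ge0 ?powR_ge0 ?(ltW g0)// => /(_ isT isT) Ht.
rewrite -[leRHS]powt//.
apply: (@le_trans _ _
    (gamma `^ (1 - t) * morrey_term p1 q1 x m N gamma `^ t)); last first.
  apply: ler_pM => //; rewrite ?powR_ge0//.
  by apply: ge0_ler_powR; rewrite ?nnegrE ?subr_ge0 ?(ltW K_gt0) ?(ltW g0)//.
rewrite /morrey_term !powRM ?mulr_ge0 ?powR_ge0 ?ler0n ?(ltW g0)//.
rewrite !mulrA powt// -!powRrM.
(* The level-set factors now agree. The window has at least one element, so it remains to compare
   its exponents: [1 / q2 <= t / q1], which is [q1 / q2 <= p1 / p2]. *)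
have p1t : 1 / p1 * t = 1 / p2 by rewrite /t mulrA div1r mulVf ?gt_eqF.
rewrite p1t ler_wpM2r ?powR_ge0// ler_wpM2l ?(ltW g0)//.
apply: ler_powR; first by rewrite card_window ler1n.
by rewrite mulrBl p1t lerD2r !div1r ler_pdivlMl.
Qed.

Lemma weak_morrey_norm_antitone p1 q1 p2 q2 x :
  1 <= p1 -> 1 <= q1 -> 1 <= q2 -> p1 <= p2 -> q1 / q2 <= p1 / p2 ->
  weak_morrey R k p1 q1 x ->
  (weak_morrey_norm p2 q2 x <= weak_morrey_norm p1 q1 x)%E.
Proof.
move=> hp1 hq1 hq2 hp hq; rewrite /weak_morrey /=.
have le_norm := @morrey_term_le_norm p1 q1 x.
case: (weak_morrey_norm p1 q1 x) le_norm => [K| |] le_norm //.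
  move=> _; apply: weak_morrey_norm_le => m N gamma g0.
  exact: (@morrey_term_interpolate p1 q1).
(* A supremum above a real term is not [-oo]. *)
by have := le_norm 0 0%N 1 ltr01; rewrite leeNy_eq.
Qed.

(** Pigeonhole: otherwise [A] would fit in a window centred at 0 with fewer elements than [A]. *)
Lemma exists_large_in_fset (A : {fset int}) : (0 < #|` A|)%N ->
  exists2 j : int, j \in A & (#|` A| <= `|j|.+1.*2)%N.
Proof.
move=> A_gt0; apply: contrapT => noj.
have small j : j \in A -> (`|j|.+1.*2 < #|` A|)%N.
  by move=> jA; rewrite ltnNge; apply/negP => h; apply: noj; exists j.
have sub : (A `<=` window 0 (#|` A|./2.-1))%fset.
  by apply/fsubsetP => j /small; rewrite in_window; lia.
have := fsubset_leq_card sub; rewrite card_window.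
have /fset0Pn[j /small] : A != fset0 by rewrite -cardfs_gt0.
lia.
Qed.

Definition power_seq q (j : int) : scalars R k :=
  of_real (`|j|.+1%:R `^ (- (1 / q))).

Lemma modulus_power_seq q j :
  modulus (power_seq q j) = `|j|.+1%:R `^ (- (1 / q)).
Proof. by rewrite modulus_of_real ger0_norm// powR_ge0. Qed.

(** If [n > 0] entries exceed [gamma], one of them has an index with [n <= 2 (|j| + 1)], hence
    [gamma * n^(1/q) <= 2^(1/q)]. *)
Lemma power_seq_weak_morrey p q : 1 <= p -> p <= q ->
  weak_morrey R k p q (power_seq q).
Proof.
move=> p_ge1 pq; have p_gt0 : 0 < p by lra.
have q_gt0 : 0 < q by lra.
apply: le_lt_trans (ltry (2 `^ (1 / q))).
apply: weak_morrey_norm_le => m N gamma g0.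
have [n0|n_gt0] := posnP #|` level_set (power_seq q) m N gamma|.
  by rewrite morrey_term_empty// powR_ge0.
have [j /level_setP[_]] := exists_large_in_fset n_gt0.
have := card_level_set_le (power_seq q) m N gamma.
rewrite modulus_power_seq /morrey_term.
move: n_gt0; set n := #|` level_set _ _ _ _| => n_gt0 nW gj nj.
have n_neq0 : n%:R != 0 :> R by rewrite pnatr_eq0 -lt0n.
have j_gt0 : 0 < `|j|.+1%:R :> R by rewrite ltr0n.
(* As [1 / q - 1 / p <= 0], replacing the window size by the smaller [n] can only increase the
   term. *)
apply: (@le_trans _ _ (gamma * n%:R `^ (1 / q))).
  rewrite -mulrA ler_wpM2l ?(ltW g0)//.
  rewrite -[in leRHS](subrK (1 / p) (1 / q)) [leRHS]powRD; last first.
    by rewrite n_neq0 implybT.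
  rewrite ler_wpM2r ?powR_ge0//.
  rewrite -opprB !powRN lef_pV2 ?posrE ?powR_gt0 ?ltr0n ?card_window//.
  apply: ge0_ler_powR; rewrite ?nnegrE ?ler0n// ?ler_nat -?(card_window m)//.
  by rewrite subr_ge0 !div1r lef_pV2.
apply: (@le_trans _ _ (`|j|.+1%:R `^ (- (1 / q)) * (`|j|.+1.*2%:R `^ (1 / q)))).
  rewrite ler_pM ?powR_ge0 ?(ltW g0) ?(ltW gj)//.
  by apply: ge0_ler_powR; rewrite ?nnegrE ?ler0n ?ler_nat// divr_ge0 ?ltW.
rewrite -mul2n natrM powRM// mulrCA -powRD ?addNr ?powRr0 ?mulr1//.
by rewrite (gt_eqF j_gt0) implybT.
Qed.

Lemma power_seq_not_weak_morrey p1 q1 q2 : 1 <= p1 -> 1 <= q1 -> q1 < q2 ->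
  ~ weak_morrey R k p1 q1 (power_seq q2).
Proof.
move=> hp1 hq1 q12; rewrite /weak_morrey /=.
have q1_gt0 : 0 < q1 by lra.
have q2_gt0 : 0 < q2 by lra.
have le_norm := @morrey_term_le_norm p1 q1 (power_seq q2).
case: (weak_morrey_norm _ _ _) le_norm => [K| |] le_norm //; last first.
  by have := le_norm 0 0%N 1 ltr01; rewrite leeNy_eq.
move=> _.
pose d := 1 / q1 - 1 / q2.
have d_gt0 : 0 < d by rewrite subr_gt0 !div1r ltf_pV2.
pose B : R := `|K| + 1.
have B_gt0 : 0 < B by rewrite ltr_wpDl.
(* Chosen so that [(N + 2)^d] exceeds [B], and thus [K]. *)
pose N := (Num.truncn (B `^ d^-1)).+1.
have BN : B `^ d^-1 < N.+2%:R.
  by apply: lt_le_trans (truncnS_gt _) _; rewrite ler_nat (leq_addl 2).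
(* This level is the value of the sequence at [|j| = N + 1], just outside the window, so every entry
   inside is strictly larger. *)
have g0 : 0 < N.+2%:R `^ (- (1 / q2)) :> R by rewrite powR_gt0 ?ltr0n.
have := le_norm 0 N _ g0; rewrite morrey_term_full//; last first.
  move=> j; rewrite in_window modulus_power_seq => jN.
  rewrite !powRN ltf_pV2 ?posrE ?powR_gt0 ?ltr0n//.
  apply: gt0_ltr_powR; rewrite ?nnegrE ?ler0n//; first by rewrite divr_gt0.
  by rewrite ltr_nat; lia.
rewrite lee_fin; apply/negP; rewrite -ltNge.
apply: (@lt_le_trans _ _ B).
  by rewrite /B; have := ler_norm K; lra.
have -> : B = (B `^ d^-1) `^ d.
  by rewrite -powRrM mulVf ?gt_eqF// powRr1// ltW.
apply: (@le_trans _ _ (N.+2%:R `^ d)).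
  by apply: ge0_ler_powR; rewrite ?nnegrE ?powR_ge0 ?ler0n// ltW.
rewrite /d addrC powRD; last by rewrite pnatr_eq0 implybT.
rewrite ler_wpM2l ?powR_ge0//.
(* Here [N + 2 <= 2 N + 1], because [N] is a successor. *)
apply: ge0_ler_powR; rewrite ?nnegrE ?ler0n ?ler_nat//.
  by rewrite divr_ge0// ltW.
by rewrite /N; lia.
Qed.

End WeakMorrey.

Theorem theorem2p11 (R : realType) (k : scalar_kind) (p1 q1 p2 q2 : R)
    (hp1 : 1 <= p1) (hpq1 : p1 <= q1) (hp2 : 1 <= p2) (hpq2 : p2 <= q2) :
  (p1 <= p2 -> q1 / q2 <= p1 / p2 ->
     weak_morrey R k p1 q1 `<=` weak_morrey R k p2 q2 /\
     forall x : int -> scalars R k, weak_morrey R k p1 q1 x ->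
       (weak_morrey_norm p2 q2 x <= weak_morrey_norm p1 q1 x)%E) /\
  ((p1 < p2 /\ q1 / q2 <= p1 / p2) \/ (p1 <= p2 /\ q1 / q2 < p1 / p2) ->
     weak_morrey R k p2 q2 `\` weak_morrey R k p1 q1 !=set0).
Proof.
have hq1 : 1 <= q1 by lra.
have hq2 : 1 <= q2 by lra.
have p2_gt0 : 0 < p2 by lra.
have q2_gt0 : 0 < q2 by lra.
split=> [hp hq|strict].
  have le_norm x : weak_morrey R k p1 q1 x ->
      (weak_morrey_norm p2 q2 x <= weak_morrey_norm p1 q1 x)%E.
    exact: weak_morrey_norm_antitone.
  by split=> // x xM; apply: le_lt_trans (le_norm x xM) xM.
(* In both cases [q1 / q2 <= p1 / p2 <= 1], with one of the two inequalities strict. *)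
have q12 : q1 < q2.
  rewrite -[q2]mul1r -ltr_pdivrMr//.
  case: strict => -[hp hq].
    by apply: le_lt_trans hq _; rewrite ltr_pdivrMr// mul1r.
  by apply: lt_le_trans hq _; rewrite ler_pdivrMr// mul1r.
exists (power_seq k q2); split; first exact: power_seq_weak_morrey.
exact: power_seq_not_weak_morrey.
Qed.
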